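(* Let $\gamma>0$ be a constant and let $F=(f_{ij})_{2\le i,j\le n}$ be a deterministic $(n-1)\times(n-1)$ complex matrix with $|f_{ij}|\le n^{\gamma}$ for all $i,j$. Let $X=(x_{ij})_{1\le i,j\le n}$ be chosen uniformly from the set of $n\times n$ doubly stochastic matrices and let $\bar X=(x_{ij}-x_{i1})_{2\le i,j\le n}$. Then for every constant $B>0$ there exists a constant $A>0$ such that, for all sufficiently large $n$, \[ \mathbb{P}\big(\sigma_{n-1}(\bar X+F)\le n^{-A}\big)\le n^{-B}, \] where $\sigma_{n-1}(\cdot)$ denotes the smallest singular value of an $(n-1)\times(n-1)$ matrix.
   Context: A real $n\times n$ matrix is doubly stochastic if its entries are nonnegative and all row and column sums equal $1$; ''chosen uniformly'' means according to normalized Lebesgue measure on the set of such matrices, identified via $X\mapsto(x_{ij})_{2\le i,j\le n}$ with a full-dimensional convex body in $\mathbb{R}^{(n-1)^2}$. *)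

(* Defs.v *)
From HB Require Import structures.
From mathcomp Require Import all_boot all_order all_algebra.
From mathcomp Require Import complex.
From mathcomp Require Import all_classical all_reals all_analysis.

Set Implicit Arguments.
Unset Strict Implicit.
Unset Printing Implicit Defensive.

Import Order.TTheory GRing.Theory Num.Theory.
Local Open Scope classical_set_scope.
Local Open Scope ring_scope.
Local Open Scope complex_scope.
Local Open Scope sesquilinear_scope.

Section tuple_lebesgue.
Context (R : realType).

Definition pair_cons k (p : R * k.-tuple R) : k.+1.-tuple R :=
  [the k.+1.-tuple R of p.1 :: p.2].

Lemma measurable_pair_cons k : measurable_fun [set: R * k.-tuple R] (@pair_cons k).
Proof. by apply: measurable_cons; [exact: measurable_fst|exact: measurable_snd]. Qed.

Lemma measurable_tuple_box k (A : 'I_k -> set R) :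
  (forall i, measurable (A i)) ->
  measurable [set t : k.-tuple R | forall i, A i (tnth t i)].
Proof.
move=> mA; rewrite (_ : [set t | _] =
    \big[setI/setT]_(i < k) ((fun t : k.-tuple R => tnth t i) @^-1` A i)).
  apply: bigsetI_measurable => i _.
  by rewrite -[X in measurable X]setTI; exact: measurable_tnth.
rewrite -bigcap_seq; apply/seteqP; split=> [t tA i _|t tA i]; first exact: tA.
by apply: tA; rewrite /= mem_index_enum.
Qed.

Section cons_measure.
Context (k : nat) (mu : {sigma_finite_measure set (k.-tuple R) -> \bar R}).

Definition cons_measure : set (k.+1.-tuple R) -> \bar R :=
  pushforward (@lebesgue_measure R \x mu)%E (@pair_cons k).

Let cons_measure0 : cons_measure set0 = 0%E.
Proof. by rewrite /cons_measure /pushforward preimage_set0 measure0. Qed.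

Let cons_measure_ge0 A : (0 <= cons_measure A)%E.
Proof. by rewrite /cons_measure /pushforward; apply: measure_ge0. Qed.

Let cons_measure_sigma_additive : semi_sigma_additive cons_measure.
Proof.
move=> F mF tF mUF; rewrite /cons_measure /pushforward preimage_bigcup.
have mpre B : measurable B -> measurable (@pair_cons k @^-1` B).
  by move=> mB; rewrite -[X in measurable X]setTI; exact: measurable_pair_cons.
apply: measure_semi_sigma_additive.
- by move=> n; exact: mpre.
- apply/trivIsetP => /= i j _ _ ij; rewrite -preimage_setI.
  by move/trivIsetP : tF => /(_ _ _ _ _ ij) ->//; rewrite preimage_set0.
- by rewrite -preimage_bigcup; exact: mpre.
Qed.

HB.instance Definition _ := isMeasure.Build _ _ _ cons_measure
  cons_measure0 cons_measure_ge0 cons_measure_sigma_additive.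

Lemma cons_measureX (A : set R) (B : set (k.-tuple R)) :
  measurable A -> measurable B ->
  cons_measure [set t | A (thead t) /\ B [tuple of behead t]] =
  (lebesgue_measure A * mu B)%E.
Proof.
move=> mA mB; rewrite -product_measure1E//= /cons_measure /pushforward.
congr (product_measure1 _ _ _); apply/seteqP.
have bE (x : R) (t : k.-tuple R) : [tuple of behead (pair_cons (x, t))] = t.
  exact/val_inj.
by split=> -[x t] /=; rewrite theadE bE.
Qed.

Let cons_measure_sigma_finite : sigma_finite setT cons_measure.
Proof.
have /sigma_finiteP[F [TF ndF Foo]] := sigma_finiteT (@lebesgue_measure R).
have /sigma_finiteP[G [TG ndG Goo]] := sigma_finiteT mu.
exists (fun n => [set t | F n (thead t) /\ G n [tuple of behead t]]).
  apply/esym; rewrite -subTset => t _.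
  have [n _ Fn] : (\bigcup_i F i) (thead t) by rewrite -TF.
  have [p _ Gp] : (\bigcup_i G i) [tuple of behead t] by rewrite -TG.
  exists (maxn n p) => //; split.
  - by move: Fn; exact/subsetPset/ndF/leq_maxl.
  - by move: Gp; exact/subsetPset/ndG/leq_maxr.
move=> n; have [mF Fn] := Foo n; have [mG Gn] := Goo n; split.
  apply: measurableI; rewrite -[X in measurable X]setTI.
    by rewrite (_ : @thead _ _ = (@tnth _ _ ^~ ord0))//; exact: measurable_tnth.
  exact: measurable_behead.
by rewrite cons_measureX// lte_mul_pinfty// ge0_fin_numE.
Qed.

HB.instance Definition _ := Measure_isSigmaFinite.Build _ _ _ cons_measure
  cons_measure_sigma_finite.

End cons_measure.

(* The k-fold product of lebesgue_measure, transported to k-tuples along cons *)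
Fixpoint tuple_lebesgue k : {sigma_finite_measure set (k.-tuple R) -> \bar R} :=
  match k with
  | 0 => \d_[tuple]
  | k'.+1 => cons_measure (tuple_lebesgue k')
  end.

Lemma tuple_lebesgue_box k (A : 'I_k -> set R) :
  (forall i, measurable (A i)) ->
  tuple_lebesgue k [set t | forall i, A i (tnth t i)] =
  (\prod_(i < k) lebesgue_measure (A i))%E.
Proof.
elim: k A => [|k IHk] A mA.
  rewrite big_ord0 /= diracE mem_set//=; by case.
have mA' i : measurable (A (lift ord0 i)) by exact: mA.
rewrite big_ord_recl /= -(IHk _ mA').
rewrite -(cons_measureX _ (mA ord0) (measurable_tuple_box mA')).
congr (cons_measure _ _); apply/seteqP.
have bE (t : k.+1.-tuple R) i : tnth [tuple of behead t] i = tnth t (lift ord0 i).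
  by rewrite tnth_behead; congr tnth; apply/val_inj; rewrite /= inordK ?ltnS.
split=> t /=; first by move=> tA; split=> [|i]; [exact: tA|rewrite bE].
by case=> t0 tA i; case: (unliftP ord0 i) => [j ->|->//]; rewrite -bE.
Qed.

End tuple_lebesgue.

Section doubly_stochastic.
Context (R : realType).

Definition doubly_stochastic n : set 'M[R]_n :=
  [set X | [/\ forall i j, 0 <= X i j,
               forall i, \sum_j X i j = 1 &
               forall j, \sum_i X i j = 1]].

(* The coordinates (x_ij)_{2 <= i, j <= n} of an n x n matrix, where n = m + 1
   and the index 1 is ord0, listed row by row. *)
Definition free_coords m (X : 'M[R]_m.+1) : (m * m).-tuple R :=
  [tuple mxvec (row' ord0 (col' ord0 X)) ord0 k | k < m * m].

Definition birkhoff_body m : set ((m * m).-tuple R) :=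
  @free_coords m @` @doubly_stochastic m.+1.
Arguments birkhoff_body : clear implicits.

Definition uniform_doubly_stochastic d (T : measurableType d)
    (P : probability T R) m (X : T -> 'M[R]_m.+1) : Prop :=
  [/\ forall w, doubly_stochastic (X w),
      measurable_fun [set: T] (fun w => free_coords (X w)) &
      forall U : set ((m * m).-tuple R), measurable U ->
        P [set w | U (free_coords (X w))] =
        (tuple_lebesgue R (m * m) (U `&` birkhoff_body m) /
         tuple_lebesgue R (m * m) (birkhoff_body m))%E].

Definition reduced_mx m (X : 'M[R]_m.+1) : 'M[R]_m :=
  \matrix_(i, j) (X (lift ord0 i) (lift ord0 j) - X (lift ord0 i) ord0).

End doubly_stochastic.

Section singular_values.
Context (R : realType).

Definition singular_values m (M : 'M[R[i]]_m) : set R :=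
  [set s | 0 <= s /\ eigenvalue (M^t* *m M) (s ^+ 2)%:C].

(* singular_values M is finite, and nonempty for m > 0, so that the infimum is
   attained; the value at m = 0 is junk. *)
Definition smallest_singular_value m (M : 'M[R[i]]_m) : R :=
  inf (singular_values M).

End singular_values.

(* Main.v *)
(* With Y = (x_ij) for i, j >= 2, n = m + 1 and J the all-ones matrix, the
   reduced matrix is Y (1 + J) - J, so that bar X + F = W (1 + J) where W = Y + G
   for a deterministic matrix G, and 1 + J has the bounded inverse 1 - J / n.
   If the smallest singular value is small, then |det W| <= kappa |cof_ij W| for
   some (i, j) and a small kappa.  As det W is affine in y_ij with slope cof_ij W,
   this event confines y_ij, given the other entries, to a disc of radius kappa;
   its translates along y_ij by multiples of tau > 2 kappa are thus disjoint, and N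
   of them fit into the body of doubly stochastic matrices when all the entries of
   X are at least e = N tau, so that the event has probability at most 1 / N there.  The
   map X |-> (1 - n e) X + e J sends that body onto the part where all the entries
   are at least e, which has therefore relative volume
   (1 - n e) ^ (m ^ 2) >= 1 - m ^ 2 n e.  The degenerate case det W = 0 is treated
   by the same translation argument applied to the leading minors of W. *)

Require Import Defs.
From HB Require Import structures.
From mathcomp Require Import all_boot all_order all_algebra.
From mathcomp Require Import complex.
From mathcomp Require Import all_classical all_reals all_analysis.
From mathcomp Require Import measurable_realfun ring lra.

Set Implicit Arguments.
Unset Strict Implicit.
Unset Printing Implicit Defensive.

Import Order.TTheory GRing.Theory Num.Theory.
Import numFieldNormedType.Exports.
Local Open Scope classical_set_scope.
Local Open Scope ring_scope.
Local Open Scope complex_scope.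

(** * Scaling and translation of Lebesgue measure on tuples *)

Section affine_change_of_variables.
Context (R : realType).

Definition affine_tuple k (a : R) (b : 'I_k -> R) (t : k.-tuple R) : k.-tuple R :=
  [tuple a * tnth t i + b i | i < k].

Lemma measurable_affine (a b : R) :
  measurable_fun [set: measurableTypeR R]
    ((fun x => a * x + b) : measurableTypeR R -> measurableTypeR R).
Proof.
apply: measurable_funD; last exact: measurable_cst.
by apply: measurable_funM; [exact: measurable_cst|exact: measurable_id].
Qed.

Lemma measurable_affine_tuple k (a : R) (b : 'I_k -> R) :
  measurable_fun [set: k.-tuple R] (affine_tuple a b).
Proof.
apply/measurable_fun_tnthP => i.
rewrite (_ : _ \o _ = fun t => a * tnth t i + b i); last first.
  by apply/funext => t /=; rewrite tnth_mktuple.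
apply: measurable_funD; last exact: measurable_cst.
by apply: measurable_funM; [exact: measurable_cst|exact: measurable_tnth].
Qed.

Lemma measurable_affine_tuple_preimage k (a : R) (b : 'I_k -> R) A :
  measurable A -> measurable (affine_tuple a b @^-1` A).
Proof.
by move=> mA; rewrite -[X in measurable X]setTI; exact: measurable_affine_tuple.
Qed.

(** Uniqueness of Lebesgue measure: [a] times the pushforward along [x |-> a x + b] gives every
    half-open interval its length. *)
Lemma lebesgue_measure_affine (a b : R) (A : set R) : 0 < a -> measurable A ->
  (a%:E * lebesgue_measure ((fun x : R => a * x + b)%R @^-1` A) =
   lebesgue_measure A)%E.
Proof.
move=> a0 mA.
pose m := mscale (NngNum (ltW a0)) (pushforward lebesgue_measure
  ((fun x => a * x + b) : measurableTypeR R -> measurableTypeR R)).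
rewrite [RHS](@lebesgue_measure_unique _ (m (measurable_affine a b)))//.
move=> _ [[u v]] _ <- /=; rewrite /m /mscale /= /pushforward.
rewrite (_ : _ @^-1` _ = `](u - b) / a, (v - b) / a]%classic); last first.
  apply/seteqP; split=> x; rewrite /= !in_itv/=;
  by rewrite ltr_pdivrMr// ler_pdivlMr// ltrBlDr lerBrDr mulrC.
rewrite !lebesgue_measure_itv/= !lte_fin ltr_pM2r ?invr_gt0// ltrD2r.
case: ifPn => _; last by rewrite mule0.
by rewrite -!EFinB -EFinM; congr EFin; field; rewrite gt_eqF.
Qed.

Definition affine_cons k (a b : R) (c : 'I_k -> R)
    (p : measurableTypeR R * k.-tuple R) : measurableTypeR R * k.-tuple R :=
  (a * p.1 + b, affine_tuple a c p.2).

Lemma measurable_affine_cons k (a b : R) (c : 'I_k -> R) :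
  measurable_fun [set: measurableTypeR R * k.-tuple R] (affine_cons a b c).
Proof.
apply/measurable_fun_pairP; split.
  apply: (measurableT_comp (measurable_affine a b)); exact: measurable_fst.
apply: (measurableT_comp (measurable_affine_tuple a c)); exact: measurable_snd.
Qed.

(** Induction on [k]. The map acts separately on head and tail, so uniqueness of the product measure
    reduces the claim to rectangles, where the one-dimensional case gives a factor [a] and the
    induction hypothesis [a ^+ k]. *)
Lemma tuple_lebesgue_affine k (a : R) (b : 'I_k -> R) (A : set (k.-tuple R)) :
  0 < a -> measurable A ->
  ((a ^+ k)%R%:E * tuple_lebesgue R k (affine_tuple a b @^-1` A) =
   tuple_lebesgue R k A)%E.
Proof.
move=> a0; elim: k b A => [|k IHk] b A mA.
  rewrite expr0 mul1e; congr (_ _); apply/seteqP.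
  have e (t : 0.-tuple R) : affine_tuple a b t = t by rewrite tuple0 [RHS]tuple0.
  by split=> t /=; rewrite e.
pose b' i := b (lift ord0 i).
rewrite /= /cons_measure /pushforward.
set nu := tuple_lebesgue R k.
have mp : measurable (@pair_cons R k @^-1` A).
  by rewrite -[X in measurable X]setTI; exact: measurable_pair_cons.
have an0 : 0 <= a ^+ k.+1 by rewrite exprn_ge0// ltW.
pose m := mscale (NngNum an0)
  (pushforward (@lebesgue_measure R \x nu)%E (affine_cons a (b ord0) b')).
have mac := measurable_affine_cons a (b ord0) b'.
rewrite [RHS](@product_measure_unique _ _ _ _ _ _ _ (m mac))//.
  rewrite /m /mscale/= /pushforward; congr (_ * (_ \x _) _)%E.
  have e p : affine_tuple a b (pair_cons p) = pair_cons (affine_cons a (b ord0) b' p).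
    apply: eq_from_tnth => i; rewrite tnth_mktuple.
    case: (unliftP ord0 i) => [j ->|->]; last by rewrite !tnth0.
    by rewrite /pair_cons/= !tnthS tnth_mktuple.
  by apply/seteqP; split=> p /=; rewrite e.
move=> U V mU mV.
transitivity ((a%:E * lebesgue_measure ((fun x : R => a * x + b ord0)%R @^-1` U)) *
    ((a ^+ k)%R%:E * nu (affine_tuple a b' @^-1` V)))%E; last first.
  by congr (_ * _)%E; [exact: lebesgue_measure_affine|exact: IHk].
rewrite muleACA -EFinM -exprS -product_measure1E//.
- rewrite -[X in measurable X]setTI; exact: measurable_affine.
- exact: measurable_affine_tuple_preimage.
Qed.

End affine_change_of_variables.

(** * Packing disjoint translates along one coordinate *)

Section translates.
Context (R : realType) (k : nat).
Implicit Types (t : k.-tuple R) (i : 'I_k) (s : R).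

(** Written as an affine map with factor 1, so that translation invariance is a case of the scaling
    formula. *)
Definition shift_coord i s t : k.-tuple R := affine_tuple 1 (fun j => s *+ (j == i)) t.

Lemma shift_coord0 i t : shift_coord i 0 t = t.
Proof. by apply: eq_from_tnth => j; rewrite tnth_mktuple mul1r mul0rn addr0. Qed.

Lemma shift_coordD i s1 s2 t : shift_coord i (s1 + s2) t = shift_coord i s1 (shift_coord i s2 t).
Proof.
by apply: eq_from_tnth => j; rewrite !tnth_mktuple !mul1r mulrnDl [s1 *+ _ + _]addrC addrA.
Qed.

Lemma tuple_lebesgue_shift i s (A : set (k.-tuple R)) : measurable A ->
  tuple_lebesgue R k (shift_coord i s @^-1` A) = tuple_lebesgue R k A.
Proof.
move=> mA; rewrite -(tuple_lebesgue_affine (fun j => s *+ (j == i)) (@ltr01 R) mA).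
by rewrite expr1n mul1e.
Qed.

Lemma measurable_shift_preimage i s (A : set (k.-tuple R)) :
  measurable A -> measurable (shift_coord i s @^-1` A).
Proof. exact: measurable_affine_tuple_preimage. Qed.

(** The [N] translates of [A] by [0, tau, ..., (N - 1) tau] have equal measure, are pairwise
    disjoint and all lie in [K]. *)
Lemma tuple_lebesgue_translates (A K : set (k.-tuple R)) i (tau : R) (N : nat) :
  measurable A -> measurable K ->
  (forall t l, A t -> (l < N)%N -> K (shift_coord i (tau *+ l) t)) ->
  (forall t l, A t -> (0 < l)%N -> ~ A (shift_coord i (tau *+ l) t)) ->
  (N%:R%:E * tuple_lebesgue R k A <= tuple_lebesgue R k K)%E.
Proof.
move=> mA mK AK AA.
(* The translate of [A] by [l tau], as a preimage under the opposite shift so that measurability and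
   invariance apply directly. *)
pose F l := shift_coord i (- (tau *+ l)) @^-1` A.
have mF l : measurable (F l) by exact: measurable_shift_preimage.
have mUF : measurable (\big[setU/set0]_(l < N) F l) by exact: bigsetU_measurable.
have tF : trivIset setT F.
  have FF l l' t : (l < l')%N -> F l t -> F l' t -> False.
    move=> ll' Fl Fl'; apply: (AA _ (l' - l)%N Fl'); rewrite ?subn_gt0//.
    rewrite -shift_coordD mulrnBr; last exact: ltnW.
    by rewrite addrAC subrr add0r.
  apply/trivIsetP => l l' _ _ ll'; apply/seteqP; split=> t //= -[Fl Fl'].
  by move: ll'; rewrite neq_ltn => /orP[/FF|/FF]; apply; eassumption.
have -> : (N%:R%:E * tuple_lebesgue R k A = \sum_(l < N) tuple_lebesgue R k (F l))%E.
  under eq_bigr do rewrite tuple_lebesgue_shift//.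
  by rewrite sumr_const card_ord mule_natl.
rewrite -measure_bigsetU//; apply: le_measure; rewrite ?inE//.
rewrite -bigcup_mkord => t [l /= lN Fl].
rewrite -(shift_coord0 i t) -(subrr (tau *+ l)) shift_coordD; exact: AK.
Qed.

End translates.

(** * Free coordinates on the Birkhoff polytope *)

Section completion.
Context (R : realType) (m : nat).
Implicit Types (t : (m * m).-tuple R) (X : 'M[R]_m.+1).

Definition free_mx t : 'M[R]_m := \matrix_(i, j) tnth t (mxvec_index i j).

(** The only matrix with free block [t] whose rows and columns all sum to 1; it inverts
    [free_coords] there. *)
Definition completion_mx t : 'M[R]_m.+1 :=
  \matrix_(i, j) match unlift ord0 i, unlift ord0 j with
  | Some i', Some j' => free_mx t i' j'
  | Some i', None => 1 - \sum_l free_mx t i' l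
  | None, Some j' => 1 - \sum_l free_mx t l j'
  | None, None => 1 - \sum_l (1 - \sum_l' free_mx t l' l)
  end.

Lemma free_mx_coords X i j : free_mx (free_coords X) i j = X (lift ord0 i) (lift ord0 j).
Proof. by rewrite mxE tnth_mktuple mxvecE !mxE. Qed.

Lemma completion_mx_coords X : doubly_stochastic X -> completion_mx (free_coords X) = X.
Proof.
case=> _ rX cX; have r i : X i ord0 = 1 - \sum_j X i (lift ord0 j).
  by rewrite -(rX i) big_ord_recl addrK.
have c j : X ord0 j = 1 - \sum_i X (lift ord0 i) j.
  by rewrite -(cX j) big_ord_recl addrK.
apply/matrixP => i j; rewrite mxE.
case: (unliftP ord0 i) => [i' ->|->]; case: (unliftP ord0 j) => [j' ->|->].
- exact: free_mx_coords.
- by rewrite r; congr (_ - _); apply: eq_bigr => l _; exact: free_mx_coords.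
- by rewrite c; congr (_ - _); apply: eq_bigr => l _; exact: free_mx_coords.
- rewrite r; congr (_ - _); apply: eq_bigr => l _; rewrite c; congr (_ - _).
  by apply: eq_bigr => l' _; exact: free_mx_coords.
Qed.

Lemma coords_completion_mx t : free_coords (completion_mx t) = t.
Proof.
apply: eq_from_tnth => k; rewrite tnth_mktuple.
by case/mxvec_indexP: k => i j; rewrite mxvecE !mxE !liftK mxE.
Qed.

Definition birkhoff_inner (e : R) : set ((m * m).-tuple R) :=
  [set t | forall i j, e <= completion_mx t i j].

(** A completion has unit row and column sums by construction, so only nonnegativity of its entries
    is left to require. *)
Lemma birkhoff_bodyE : @birkhoff_body R m = birkhoff_inner 0.
Proof.
apply/seteqP; split=> [_ [X dX <-] i j|t t0].
  by rewrite completion_mx_coords//; case: dX.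
exists (completion_mx t); last exact: coords_completion_mx.
split=> // [i|j]; rewrite big_ord_recl.
  rewrite (eq_bigr (fun l => if unlift ord0 i is Some i' then free_mx t i' l
    else 1 - \sum_l' free_mx t l' l)); last by move=> l _; rewrite mxE liftK.
  by rewrite mxE unlift_none; case: unliftP => [i' _|_]; rewrite subrK.
(* The corner is defined through the first row; that the first column sums to 1 as well comes from
   exchanging the double sum over the free block. *)
rewrite (eq_bigr (fun l => if unlift ord0 j is Some j' then free_mx t l j'
    else 1 - \sum_l' free_mx t l l')); last by move=> l _; rewrite mxE liftK.
rewrite mxE unlift_none; case: unliftP => [j' _|_]; first by rewrite subrK.
rewrite !sumrB exchange_big/=; ring.
Qed.

Lemma measurable_birkhoff_inner e : measurable (birkhoff_inner e).
Proof.
rewrite (_ : birkhoff_inner e =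
  \bigcap_(i in [set: 'I_m.+1]) \bigcap_(j in [set: 'I_m.+1])
     [set t | e <= completion_mx t i j]); last first.
  by apply/seteqP; split=> [t te i _ j _|t te i j]; [exact: te|exact: te].
apply: fin_bigcap_measurable => // i _; apply: fin_bigcap_measurable => // j _.
have mf i' j' : measurable_fun setT (fun t => free_mx t i' j').
  rewrite (_ : (fun t => _) = (fun t => tnth t (mxvec_index i' j'))).
    exact: measurable_tnth.
  by apply/funext => t; rewrite mxE.
have mc : measurable_fun setT (fun t => completion_mx t i j).
  rewrite (_ : (fun t => _) = fun t => match unlift ord0 i, unlift ord0 j with
  | Some i', Some j' => free_mx t i' j'
  | Some i', None => 1 - \sum_l free_mx t i' l
  | None, Some j' => 1 - \sum_l free_mx t l j'
  | None, None => 1 - \sum_l (1 - \sum_l' free_mx t l' l)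
  end); last by apply/funext => t; rewrite mxE.
  case: (unlift ord0 i) => [i'|]; case: (unlift ord0 j) => [j'|] //;
    (apply: measurable_funB; first exact: measurable_cst);
    apply: measurable_sum => l //; apply: measurable_funB => //.
  exact: measurable_sum.
rewrite (_ : [set t | _] = setT `&` (fun t => completion_mx t i j) @^-1` `[e, +oo[).
  exact: mc.
by rewrite setTI; apply/seteqP; split=> t /=; rewrite in_itv/= andbT.
Qed.

(** The condition on [a] and [b] says that [X |-> a X + b J], with [J] all ones of size [m + 1],
    preserves unit row and column sums, hence commutes with completion. *)
Lemma completion_mx_affine (a b : R) t i j : a + m.+1%:R * b = 1 ->
  completion_mx (affine_tuple a (fun=> b) t) i j = a * completion_mx t i j + b.
Proof.
move=> ab1; have af i' j' : free_mx (affine_tuple a (fun=> b) t) i' j' =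
    a * free_mx t i' j' + b by rewrite !mxE tnth_mktuple.
have ab : a = 1 - m.+1%:R * b by rewrite -[LHS](addrK (m.+1%:R * b)) ab1.
have sumD (f : 'I_m -> R) : \sum_l (a * f l + b) = a * \sum_l f l + m%:R * b.
  by rewrite big_split/= -mulr_sumr sumr_const card_ord mulr_natl.
rewrite !mxE; case: (unliftP ord0 i) => [i' _|_]; case: (unliftP ord0 j) => [j' _|_].
- exact: af.
- under eq_bigr do rewrite af.
  rewrite sumD ab -natr1; ring.
- under eq_bigr do rewrite af.
  rewrite sumD ab -natr1; ring.
- rewrite (eq_bigr (fun l => a * (1 - \sum_l' free_mx t l' l) + b)).
    rewrite sumD ab -natr1; ring.
  move=> l _; under eq_bigr do rewrite af.
  rewrite sumD ab -natr1; ring.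
Qed.

(** The preimage of [birkhoff_inner b] under [X |-> (1 - n b) X + b J] is [birkhoff_inner 0]; the
    power is the Jacobian in [m * m] coordinates. *)
Lemma tuple_lebesgue_birkhoff_inner (b : R) : 0 < 1 - m.+1%:R * b ->
  (((1 - m.+1%:R * b) ^+ (m * m))%R%:E * tuple_lebesgue R _ (birkhoff_inner 0) =
   tuple_lebesgue R _ (birkhoff_inner b))%E.
Proof.
move=> a0; have mi := measurable_birkhoff_inner b.
rewrite -(tuple_lebesgue_affine (fun=> b) a0 mi).
congr (_ * tuple_lebesgue R _ _)%E.
apply/seteqP; split=> t /= tb i j; have := tb i j;
  by rewrite completion_mx_affine ?subrK// lerDr pmulr_rge0.
Qed.

Lemma mxvec_index_eq (i i' j j' : 'I_m) :
  (mxvec_index i j == mxvec_index i' j') = (i == i') && (j == j').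
Proof.
have := mxvecE (delta_mx i' j' : 'M[R]_m) i j; rewrite mxvec_delta !mxE eqxx/=.
by move=> /eqP; rewrite eqr_nat; case: (_ == mxvec_index _ _); case: (_ && _).
Qed.

Lemma free_mx_shift t i j s :
  free_mx (shift_coord (mxvec_index i j) s t) = free_mx t + s *: delta_mx i j.
Proof.
apply/matrixP => i' j'; rewrite !mxE tnth_mktuple mul1r; congr (_ + _).
by rewrite mulr_natr mxvec_index_eq.
Qed.

(** Raising one free entry by [s] lowers by [s] the dependent entry of its row and that of its
    column, and raises the corner by [s]. The lowered entries were at least [e >= s]. *)
Lemma birkhoff_inner_shift (e s : R) i j t : 0 <= s <= e ->
  birkhoff_inner e t -> birkhoff_inner 0 (shift_coord (mxvec_index i j) s t).
Proof.
move=> /andP[s0 se] te i' j'.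
have rowD a : \sum_l s * (delta_mx i j : 'M[R]_m) a l = s *+ (a == i).
  rewrite -mulr_sumr (bigD1 j)//= mxE eqxx andbT big1 ?addr0 ?mulr_natr// => l lj.
  by rewrite mxE (negPf lj) andbF.
have colD a : \sum_l s * (delta_mx i j : 'M[R]_m) l a = s *+ (a == j).
  rewrite -mulr_sumr (bigD1 i)//= mxE eqxx big1 ?addr0 ?mulr_natr// => l lj.
  by rewrite mxE (negPf lj).
have sb (b : bool) : 0 <= s *+ b <= s by case: b; rewrite ?lexx ?s0.
have fD a b : (free_mx t + s *: delta_mx i j) a b =
    free_mx t a b + s * (delta_mx i j : 'M[R]_m) a b by rewrite !mxE.
have := te i' j'; rewrite !mxE free_mx_shift.
case: (unliftP ord0 i') => [a _|_]; case: (unliftP ord0 j') => [b _|_].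
- move=> h; rewrite mxE; apply: addr_ge0; first exact: le_trans (le_trans s0 se) h.
  by rewrite !mxE mulr_ge0.
- under [X in 0 <= 1 - X]eq_bigr do rewrite fD.
  by rewrite big_split/= rowD; have := sb (a == i); lra.
- under [X in 0 <= 1 - X]eq_bigr do rewrite fD.
  by rewrite big_split/= colD; have := sb (b == j); lra.
- under [X in 0 <= 1 - X]eq_bigr => l _.
    under eq_bigr do rewrite fD.
    rewrite big_split/= colD opprD addrA; over.
  rewrite [X in 0 <= 1 - X]big_split/= sumrN.
  have : 0 <= \sum_l s *+ (l == j) by rewrite sumr_ge0// => l _; case/andP: (sb (l == j)).
  by lra.
Qed.

End completion.

(** * Measurability of complex functions, determinants and cofactors *)

Section complex_measurability.
Context d (T : measurableType d) (R : realType).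
Implicit Types f g : T -> R[i].

Definition cmeasurable f :=
  measurable_fun [set: T] (fun t => complex.Re (f t)) /\
  measurable_fun [set: T] (fun t => complex.Im (f t)).

Lemma cmeasurable_cst c : cmeasurable (fun=> c).
Proof. by split; exact: measurable_cst. Qed.

Lemma cmeasurable_real (f : T -> R) :
  measurable_fun [set: T] f -> cmeasurable (fun t => (f t)%:C).
Proof. by move=> mf; split=> //; exact: measurable_cst. Qed.

Lemma cmeasurableD f g : cmeasurable f -> cmeasurable g ->
  cmeasurable (fun t => f t + g t).
Proof.
move=> [rf jf] [rg jg]; split.
  rewrite (_ : (fun t => _) = (fun t => complex.Re (f t)) \+ (fun t => complex.Re (g t))).
    exact: measurable_funD.
  by apply/funext => t /=; case: (f t) (g t) => [a b] [a' b'].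
rewrite (_ : (fun t => _) = (fun t => complex.Im (f t)) \+ (fun t => complex.Im (g t))).
  exact: measurable_funD.
by apply/funext => t /=; case: (f t) (g t) => [a b] [a' b'].
Qed.

Lemma cmeasurableM f g : cmeasurable f -> cmeasurable g ->
  cmeasurable (fun t => f t * g t).
Proof.
move=> [rf jf] [rg jg]; split.
  rewrite (_ : (fun t => _) = (fun t => complex.Re (f t) * complex.Re (g t)) \-
      (fun t => complex.Im (f t) * complex.Im (g t))).
    by apply: measurable_funB; exact: measurable_funM.
  by apply/funext => t /=; case: (f t) (g t) => [a b] [a' b'].
rewrite (_ : (fun t => _) = (fun t => complex.Re (f t) * complex.Im (g t)) \+
    (fun t => complex.Im (f t) * complex.Re (g t))).
  by apply: measurable_funD; exact: measurable_funM.
by apply/funext => t /=; case: (f t) (g t) => [a b] [a' b'].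
Qed.

Lemma cmeasurableN f : cmeasurable f -> cmeasurable (fun t => - f t).
Proof.
move=> mf; rewrite (_ : (fun t => _) = (fun t => -1 * f t)).
  by apply: cmeasurableM => //; exact: cmeasurable_cst.
by apply/funext => t; rewrite mulN1r.
Qed.

Lemma cmeasurable_conj f : cmeasurable f -> cmeasurable (fun t => (f t)^*).
Proof.
move=> [rf jf]; split.
  by rewrite (_ : (fun t => _) = fun t => complex.Re (f t))//;
    apply/funext => t /=; case: (f t).
rewrite (_ : (fun t => _) = \- (fun t => complex.Im (f t))).
  exact: measurable_funN.
by apply/funext => t /=; case: (f t).
Qed.

Lemma cmeasurable_sum I (r : seq I) (P : pred I) (F : I -> T -> R[i]) :
  (forall i, cmeasurable (F i)) -> cmeasurable (fun t => \sum_(i <- r | P i) F i t).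
Proof.
move=> mF; elim: r => [|i r IHr].
  rewrite (_ : (fun t => _) = fun=> 0); first exact: cmeasurable_cst.
  by apply/funext => t; rewrite big_nil.
rewrite (_ : (fun t => _) = fun t => (if P i then F i t else 0) +
    \sum_(j <- r | P j) F j t).
  by apply: cmeasurableD => //; case: (P i) => //; exact: cmeasurable_cst.
by apply/funext => t; rewrite big_cons; case: (P i); rewrite ?add0r.
Qed.

Lemma cmeasurable_prod I (r : seq I) (P : pred I) (F : I -> T -> R[i]) :
  (forall i, cmeasurable (F i)) -> cmeasurable (fun t => \prod_(i <- r | P i) F i t).
Proof.
move=> mF; elim: r => [|i r IHr].
  rewrite (_ : (fun t => _) = fun=> 1); first exact: cmeasurable_cst.
  by apply/funext => t; rewrite big_nil.
rewrite (_ : (fun t => _) = fun t => (if P i then F i t else 1) *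
    \prod_(j <- r | P j) F j t).
  by apply: cmeasurableM => //; case: (P i) => //; exact: cmeasurable_cst.
by apply/funext => t; rewrite big_cons; case: (P i); rewrite ?mul1r.
Qed.

Definition mx_cmeasurable m n (M : T -> 'M[R[i]]_(m, n)) :=
  forall i j, cmeasurable (fun t => M t i j).

Lemma cmeasurable_det m (M : T -> 'M[R[i]]_m) :
  mx_cmeasurable M -> cmeasurable (fun t => \det (M t)).
Proof.
move=> mM; apply: cmeasurable_sum => s; apply: cmeasurableM.
  exact: cmeasurable_cst.
exact: cmeasurable_prod.
Qed.

Lemma cmeasurable_cofactor m (M : T -> 'M[R[i]]_m) i j :
  mx_cmeasurable M -> cmeasurable (fun t => cofactor (M t) i j).
Proof.
move=> mM; apply: cmeasurableM; first exact: cmeasurable_cst.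
apply: cmeasurable_det => a b.
by rewrite (_ : (fun t => _) = fun t => M t (lift i a) (lift j b))//;
  apply/funext => t; rewrite !mxE.
Qed.

Lemma mx_cmeasurable_mul m n p (M : T -> 'M[R[i]]_(m, n)) (N : T -> 'M[R[i]]_(n, p)) :
  mx_cmeasurable M -> mx_cmeasurable N -> mx_cmeasurable (fun t => M t *m N t).
Proof.
move=> mM mN i j.
rewrite (_ : (fun t => _) = fun t => \sum_k M t i k * N t k j).
  by apply: cmeasurable_sum => k; exact: cmeasurableM.
by apply/funext => t; rewrite mxE.
Qed.

(** The squared modulus as an element of [R]; the norm on [R[i]] has its values in [R[i]]. *)
Definition normsq (z : R[i]) : R := complex.Re z ^+ 2 + complex.Im z ^+ 2.

Lemma ler_normsq (x y : R[i]) : (`|x| <= `|y|) = (normsq x <= normsq y).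
Proof. by rewrite !normc_def lecR ler_sqrt// addr_ge0// sqr_ge0. Qed.

Lemma normsq_ge0 z : 0 <= normsq z.
Proof. by rewrite addr_ge0 ?sqr_ge0. Qed.

Lemma normsq_eq0 z : (normsq z == 0) = (z == 0).
Proof. by rewrite paddr_eq0 ?sqr_ge0// !sqrf_eq0 eq_complex. Qed.

Lemma measurable_normsq f : cmeasurable f ->
  measurable_fun [set: T] (fun t => normsq (f t)).
Proof. by move=> [rf jf]; apply: measurable_funD; exact: measurable_funX. Qed.

Lemma measurable_le_norm f g : cmeasurable f -> cmeasurable g ->
  measurable [set t | `|f t| <= `|g t|].
Proof.
move=> /measurable_normsq mf /measurable_normsq mg.
rewrite (_ : [set t | _] = (fun t => normsq (f t) <= normsq (g t)) @^-1` [set true]).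
  by rewrite -[X in measurable X]setTI; exact: measurable_fun_ler.
by apply/seteqP; split=> t /=; rewrite ler_normsq.
Qed.

End complex_measurability.

(** * Slabs where the determinant is small against a cofactor *)

Section slabs.
Context (R : realType) (m : nat).
Implicit Types (t : (m * m).-tuple R) (A W : 'M[R[i]]_m).

(** A cofactor along row [i] deletes that row, the only one that changes. *)
Lemma cofactorD_delta A i j s l : cofactor (A + s *: delta_mx i j) i l = cofactor A i l.
Proof.
rewrite /cofactor; congr (_ * \det _); apply/matrixP => a b.
by rewrite !mxE [lift i a == i]eq_sym (negPf (neq_lift i a)) mulr0 addr0.
Qed.

Lemma detD_delta A i j s : \det (A + s *: delta_mx i j) = \det A + s * cofactor A i j.
Proof.
rewrite !(expand_det_row _ i).
under eq_bigr do rewrite cofactorD_delta mxE mulrDl.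
rewrite big_split/=; congr (_ + _); rewrite (bigD1 j)//= big1 ?addr0.
  by rewrite !mxE !eqxx mulr1.
by move=> l lj; rewrite !mxE (negPf lj) andbF mulr0 mul0r.
Qed.

(** The cofactor is required to be nonzero because it is the slope of the determinant in entry
    [(i, j)]: with slope 0 a translation would separate nothing. *)
Definition slab (kappa : R) i j A :=
  `|\det A| <= `|kappa%:C * cofactor A i j| /\ cofactor A i j != 0.

(** The two determinants differ by [s] times the common cofactor. If both matrices were in the slab,
    this difference would be at most [2 kappa] times the cofactor in modulus. *)
Lemma slab_shift (kappa s : R) i j A : 0 <= kappa -> kappa *+ 2 < s ->
  slab kappa i j A -> ~ slab kappa i j (A + s%:C *: delta_mx i j).
Proof.
move=> k0 ks [dA c0] [dAs _]; move: dAs; rewrite detD_delta cofactorD_delta => dAs.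
have : `|s%:C * cofactor A i j| <= `|kappa%:C * cofactor A i j| *+ 2.
  rewrite -[X in `|X|](addrK (\det A)) mulr2n (le_trans (ler_normB _ _))//.
  by rewrite lerD// addrC.
have s0 : 0 <= s by rewrite (le_trans _ (ltW ks))// mulrn_wge0.
rewrite (normrM s%:C) (normrM kappa%:C) -mulrnAl ler_pM2r ?normr_gt0//.
rewrite !ger0_norm ?(lecR 0)//.
by rewrite -rmorphMn/= lecR leNgt ks.
Qed.

Lemma measurable_slab (H : (m * m).-tuple R -> 'M[R[i]]_m) i j (kappa : R) :
  mx_cmeasurable H -> measurable [set t | slab kappa i j (H t)].
Proof.
move=> mH; have mc := cmeasurable_cofactor i j mH.
rewrite (_ : [set t | _] = [set t | `|\det (H t)| <= `|kappa%:C * cofactor (H t) i j|]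
   `\` [set t | `|cofactor (H t) i j| <= `|(0 : R[i])|]).
  apply: measurableD; apply: measurable_le_norm => //; first exact: cmeasurable_det.
    by apply: cmeasurableM => //; exact: cmeasurable_cst.
by apply/seteqP; split=> t; rewrite /= /slab normr0 normr_le0 => -[? /negP].
Qed.

(** [H] is kept abstract to cover both the full matrix and its padded leading blocks; only its
    response to a shift of coordinate [(i, j)] matters. *)
Lemma tuple_lebesgue_slab (H : (m * m).-tuple R -> 'M[R[i]]_m) i j (kappa tau e : R) N :
  mx_cmeasurable H ->
  (forall t s, H (shift_coord (mxvec_index i j) s t) = H t + s%:C *: delta_mx i j) ->
  0 <= kappa -> kappa *+ 2 < tau -> tau *+ N <= e ->
  (N%:R%:E * tuple_lebesgue R _
     ([set t | slab kappa i j (H t)] `&` @birkhoff_inner R m e) <=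
   tuple_lebesgue R _ (@birkhoff_inner R m 0))%E.
Proof.
move=> mH Hs k0 ktau Ntau.
have tau0 : 0 < tau by rewrite (le_lt_trans _ ktau)// mulrn_wge0.
have mS := measurable_slab i j kappa mH.
apply: (@tuple_lebesgue_translates _ _ _ _ (mxvec_index i j) tau).
- by apply: measurableI => //; exact: measurable_birkhoff_inner.
- exact: measurable_birkhoff_inner.
- move=> t l [_ te] lN; apply: birkhoff_inner_shift te.
  apply/andP; split; first by rewrite mulrn_wge0// ltW.
  by apply: le_trans Ntau; apply: ler_wpMn2l; [exact: ltW|exact: ltnW].
- move=> t l [St _] l0 [+ _]; rewrite /= Hs; apply: slab_shift => //.
  apply: lt_le_trans ktau _; rewrite -[leLHS]mulr1n; apply: ler_wpMn2l => //; exact: ltW.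
Qed.

End slabs.

(** * Linear algebra: from a small singular value to a slab *)

Section smallest_singular_value_bound.
Local Open Scope sesquilinear_scope.
Context (R : realType).

(* Padding with the identity gives all the leading minors of W the same type *)
Definition leading_mx m k (W : 'M[R[i]]_m) : 'M[R[i]]_m :=
  \matrix_(i, j) if (i < k)%N && (j < k)%N then W i j else (i == j)%:R.

Lemma leading_mx_full m (W : 'M[R[i]]_m) : leading_mx m W = W.
Proof. by apply/matrixP => i j; rewrite mxE !ltn_ord. Qed.

Lemma leading_mx0 m (W : 'M[R[i]]_m) : leading_mx 0 W = 1%:M.
Proof. by apply/matrixP => i j; rewrite !mxE. Qed.

(** Row [k] of [leading_mx k W] is a row of the identity, and the two padded matrices coincide once
    row and column [k] are deleted. *)
Lemma cofactor_leading_mx m (W : 'M[R[i]]_m) (k : 'I_m) :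
  cofactor (leading_mx k.+1 W) k k = \det (leading_mx k W).
Proof.
rewrite (expand_det_row _ k) (bigD1 k)//= big1 ?addr0.
  rewrite mxE ltnn/= eqxx mul1r /cofactor; congr (_ * \det _).
  apply/matrixP => a b; rewrite !mxE.
  have lt c : (lift k c < k.+1)%N = (lift k c < k)%N.
    by rewrite ltnS leq_eqVlt eq_sym val_eqE (negPf (neq_lift k c)).
  by rewrite !lt.
by move=> j jk; rewrite mxE ltnn/= eq_sym (negPf jk) mul0r.
Qed.

(** Induction over the leading minors. The previous minor is the [(k, k)] cofactor of the next
    block, so if it is nonzero and the next minor vanishes, that block lies in the slab. *)
Lemma det_neq0_of_slabs m (W : 'M[R[i]]_m) (kappa : R) :
  (forall k : 'I_m, ~ slab kappa k k (leading_mx k.+1 W)) -> \det W != 0.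
Proof.
move=> h; rewrite -(leading_mx_full W).
suff : forall k, (k <= m)%N -> \det (leading_mx k W) != 0 by exact.
elim=> [|k IHk] km; first by rewrite leading_mx0 det1 oner_neq0.
have := h (Ordinal km); rewrite /slab cofactor_leading_mx IHk//; last exact: ltnW.
by apply: contra_notN => /eqP ->; rewrite normr0.
Qed.

(** Cramer's rule writes [det W * z_i] as the sum over [j] of [cof_ji * (W z)_j]. Outside all the
    slabs each cofactor is below [|det W| / (m eta)], which makes this sum too small. *)
Lemma slab_of_small_image m (W : 'M[R[i]]_m) (z : 'cV[R[i]]_m) i (eta : R) :
  0 <= eta -> \det W != 0 -> z i 0 != 0 ->
  (forall j, `|(W *m z) j 0| <= eta%:C * `|z i 0|) ->
  exists j, slab (m%:R * eta) j i W.
Proof.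
move=> eta0 dW zi Wz; apply: contrapT => /forallNP ns.
have etaC : 0 <= eta%:C by rewrite (lecR 0).
have m0 : (0 < m)%N by case: m i {W z dW zi Wz ns} => [[]|].
have ltj j : m%:R * eta%:C * `|cofactor W j i| < `|\det W|.
  have [c0|c0] := eqVneq (cofactor W j i) 0; first by rewrite c0 normr0 mulr0 normr_gt0.
  rewrite real_ltNge ?ger0_real ?mulr_ge0//; apply/negP => le.
  apply: (ns j); split=> //; rewrite normrM.
  by rewrite [X in X * _]ger0_norm rmorphM/= rmorph_nat// ?mulr_ge0.
have : `|\det W| * `|z i 0| <= \sum_j `|cofactor W j i| * (eta%:C * `|z i 0|).
  have -> : `|\det W| * `|z i 0| = `|\sum_j cofactor W j i * (W *m z) j 0|.
    rewrite -normrM; have := congr1 (fun M : 'cV_m => M i 0) (mulmxA (\adj W) W z).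
    rewrite mul_adj_mx mul_scalar_mx !mxE => <-.
    by under [X in `|X|]eq_bigr do rewrite mxE.
  apply: le_trans (ler_norm_sum _ _ _) _; apply: ler_sum => j _.
  by rewrite normrM ler_wpM2l.
rewrite -mulr_suml mulrA ler_pM2r ?normr_gt0// => le.
have : \sum_(j < m) m%:R * eta%:C * `|cofactor W j i| < \sum_(j < m) `|\det W|.
  apply: ltr_sum => //; apply/hasP; exists i => //; exact: mem_index_enum.
rewrite -mulr_sumr sumr_const card_ord -[X in _ < X]mulr_natl -mulrA ltr_pM2l ?ltr0n//.
by rewrite mulrC => /(le_lt_trans le); rewrite ltxx.
Qed.

Lemma exists_max_norm m (z : 'cV[R[i]]_m) : (0 < m)%N ->
  exists i, forall j, `|z j 0| <= `|z i 0|.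
Proof.
case: m z => // m z _.
have [i _ imax] := @arg_maxP _ _ _ (ord0 : 'I_m.+1) xpredT (fun i => normsq (z i 0)) isT.
by exists i => j; rewrite ler_normsq; exact: imax.
Qed.

Lemma norm_sum_conj m (x : 'cV[R[i]]_m) : (x^t* *m x) 0 0 = \sum_i `|x i 0| ^+ 2.
Proof. by rewrite mxE; apply: eq_bigr => i _; rewrite !mxE normCKC. Qed.

(** [eigenvalue] provides a row eigenvector [v]; its conjugate transpose serves as [x], both sides
    being [v] times the Gram matrix times [x]. *)
Lemma eigenvalue_gram m (M : 'M[R[i]]_m) a : eigenvalue (M^t* *m M) a ->
  exists2 x : 'cV[R[i]]_m, x != 0 &
    \sum_i `|(M *m x) i 0| ^+ 2 = a * \sum_i `|x i 0| ^+ 2.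
Proof.
move=> /eigenvalueP[v vM v0]; exists (v^t*).
  by apply: contra v0 => /eqP/(congr1 (fun u => u^t*)) /=; rewrite trmxCK trmx0 map_mx0 => ->.
rewrite -!norm_sum_conj trmx_mul map_mxM trmxCK !mulmxA -(mulmxA v) vM -!scalemxAl.
by rewrite mxE.
Qed.

Lemma sum_norm_sqr_gt0 m (x : 'cV[R[i]]_m) : x != 0 -> 0 < \sum_i `|x i 0| ^+ 2.
Proof.
move=> x0; rewrite lt_def sumr_ge0 ?andbT => [|i _]; last by rewrite exprn_ge0.
apply: contra x0; rewrite psumr_eq0 => [/allP x0|i _]; last by rewrite exprn_ge0.
apply/eqP/colP => i; apply/eqP.
by have := x0 i (mem_index_enum _); rewrite /= expf_eq0/= normr_eq0 mxE.
Qed.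

(** Algebraic closedness gives an eigenvalue of the Gram matrix. The norm identity makes it real and
    nonnegative, so it has a real square root. *)
Lemma singular_values_neq0 m (M : 'M[R[i]]_m) : (0 < m)%N -> singular_values M !=set0.
Proof.
move=> m0; have [a ea] := eigenvalue_closed (M^t* *m M) m0.
have [x x0 xa] := eigenvalue_gram ea.
have a0 : 0 <= a.
  rewrite -(pmulr_lge0 _ (sum_norm_sqr_gt0 x0)) -xa.
  by rewrite sumr_ge0// => i _; rewrite exprn_ge0.
case: a a0 ea {xa} => u v; rewrite lecE/= => /andP[/eqP -> u0] ea.
exists (Num.sqrt u); split; first exact: sqrtr_ge0.
rewrite sqr_sqrtr; [exact: ea|exact: u0].
Qed.

Lemma smallest_singular_value_lt m (M : 'M[R[i]]_m) (s : R) : (0 < m)%N ->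
  smallest_singular_value M < s ->
  exists2 x : 'cV[R[i]]_m, x != 0 &
    \sum_i `|(M *m x) i 0| ^+ 2 <= (s ^+ 2)%:C * \sum_i `|x i 0| ^+ 2.
Proof.
move=> m0 /inf_lt -/(_ (singular_values_neq0 M m0))[r [r0 er] rs].
have [x x0 xa] := eigenvalue_gram er; exists x => //; rewrite xa.
apply: ler_wpM2r; first exact/ltW/sum_norm_sqr_gt0.
by rewrite lecR lerXn2r ?nnegrE// ltW// (le_lt_trans r0).
Qed.

End smallest_singular_value_bound.

(** * Measurability of the smallest singular value *)

Section smallest_singular_value_measurable.
Local Open Scope sesquilinear_scope.
Context (R : realType).

Lemma horner_char_poly n (A : 'M[R[i]]_n) x : (char_poly A).[x] = \det (x%:M - A).
Proof.
rewrite horner_sum; apply: eq_bigr => s _; rewrite hornerM horner_exp !hornerE.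
congr (_ * _); rewrite (big_morph _ (fun p q => hornerM p q x) (hornerC 1 x)).
by apply: eq_bigr => i _; rewrite !mxE !(hornerE, hornerMn).
Qed.

Lemma eigenvalue_det n (A : 'M[R[i]]_n) x : eigenvalue A x = (\det (x%:M - A) == 0).
Proof. by rewrite eigenvalue_root_char rootE horner_char_poly. Qed.

(** Splitting the coefficients into real and imaginary parts turns the function into a real
    polynomial in [x]. *)
Lemma normsq_horner_continuous (p : {poly R[i]}) :
  continuous (fun x : R => normsq p.[(x ^+ 2)%:C]).
Proof.
pose P := \poly_(i < size p) complex.Re p`_i.
pose Q := \poly_(i < size p) complex.Im p`_i.
have xnE (x : R) i : (x%:C) ^+ i = (x ^+ i)%:C by rewrite rmorphXn.
have ReD : {morph @complex.Re R : x y / x + y} by case=> a b [].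
have ImD : {morph @complex.Im R : x y / x + y} by case=> a b [].
have PE (x : R) : complex.Re p.[x%:C] = P.[x].
  rewrite horner_coef horner_poly (big_morph _ ReD (erefl : complex.Re 0 = 0)).
  by apply: eq_bigr => i _; rewrite xnE; case: (p`_i) => [a b]; rewrite /= mulr0 subr0.
have QE (x : R) : complex.Im p.[x%:C] = Q.[x].
  rewrite horner_coef horner_poly (big_morph _ ImD (erefl : complex.Im 0 = 0)).
  by apply: eq_bigr => i _; rewrite xnE; case: (p`_i) => [a b]; rewrite /= mulr0 add0r.
rewrite (_ : (fun x => _) = horner ((P ^+ 2 + Q ^+ 2) \Po 'X^2)).
  exact: continuous_horner.
apply/funext => x; rewrite /normsq PE QE horner_comp hornerXn.
by rewrite hornerD !horner_exp.
Qed.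

(** The squared modulus of the characteristic polynomial of the Gram matrix at [x ^+ 2]: its
    nonnegative zeros are the singular values. *)
Definition gram_char m (M : 'M[R[i]]_m) (x : R) : R :=
  normsq (\det ((x ^+ 2)%:C%:M - M^t* *m M)).

Lemma gram_char_continuous m (M : 'M[R[i]]_m) : continuous (gram_char M).
Proof.
rewrite (_ : gram_char M = fun x : R => normsq (char_poly (M^t* *m M)).[(x ^+ 2)%:C]).
  exact: normsq_horner_continuous.
by apply/funext => x; rewrite horner_char_poly.
Qed.

Lemma gram_char_eq0 m (M : 'M[R[i]]_m) x :
  (gram_char M x == 0) = eigenvalue (M^t* *m M) (x ^+ 2)%:C.
Proof. by rewrite normsq_eq0 eigenvalue_det. Qed.

(* Only countably many conditions, each measurable in M, appear on the right *)
Lemma smallest_singular_value_leP m (M : 'M[R[i]]_m) (s : R) : (0 < m)%N -> 0 <= s ->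
  smallest_singular_value M <= s <->
  forall l : nat, exists r : rat,
    `|ratr r| < s + l.+1%:R^-1 /\ gram_char M (ratr r) < l.+1%:R^-1.
Proof.
move=> m0 s0; split=> [le l|h].
  have l0 : 0 < l.+1%:R^-1 :> R by rewrite invr_gt0.
  have /inf_lt : smallest_singular_value M < s + l.+1%:R^-1.
    by rewrite (le_lt_trans le)// ltrDl.
  move=> /(_ (singular_values_neq0 M m0))[x [x0 ex] xs].
  (* Both conditions are open and hold at a singular value [x], so some rational satisfies them. *)
  pose O := Num.norm @^-1` [set y : R | y < s + l.+1%:R^-1] `&`
            gram_char M @^-1` [set y : R | y < l.+1%:R^-1].
  have [y [[/= r1 r2] [r _ re]]] : O `&` (@ratr R @` setT) !=set0.
    apply: dense_rat.
      exists x; split=> /=; first by rewrite ger0_norm.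
      by move: ex; rewrite -gram_char_eq0 => /eqP ->.
    apply: openI; apply: open_comp; try exact: open_lt.
      by move=> y _; exact: norm_continuous.
    by move=> y _; exact: gram_char_continuous.
  by exists r; rewrite re.
apply/ler_addgt0Pr => e e0.
have [k] := ltr_add_invr e0; rewrite add0r => ke.
set a := s + k.+1%:R^-1.
have a0 : - a <= a by rewrite ge0_cp// addr_ge0// invr_ge0.
(* By compactness the minimum on [[-a, a]] is attained. The rationals from [h] force it to be 0, so
   that [|c|] is a singular value. *)
have [c ca cmin] := EVT_min a0 (continuous_subspaceT (@gram_char_continuous _ M)).
have c0 : gram_char M c == 0.
  rewrite eq_le normsq_ge0 andbT leNgt; apply/negP => /ltr_add_invr[l].
  rewrite add0r => lc; have [r [r1 r2]] := h (maxn k l).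
  have ek : (maxn k l).+1%:R^-1 <= k.+1%:R^-1 :> R.
    by rewrite lef_pV2 ?posrE// ler_nat ltnS leq_maxl.
  have el : (maxn k l).+1%:R^-1 <= l.+1%:R^-1 :> R.
    by rewrite lef_pV2 ?posrE// ler_nat ltnS leq_maxr.
  have : gram_char M c <= gram_char M (ratr r).
    apply: cmin; rewrite in_itv/= -ler_norml ltW// (lt_le_trans r1)//.
    by rewrite lerD2l.
  by move=> /(lt_le_trans lc)/lt_trans/(_ r2)/lt_le_trans/(_ el); rewrite ltxx.
apply: (@le_trans _ _ `|c|).
  apply: ge_inf; first by exists 0 => x [].
  by split=> //; rewrite real_normK ?num_real// -gram_char_eq0.
by move: ca; rewrite in_itv/= -ler_norml => /le_trans; apply; rewrite lerD2l ltW.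
Qed.

Lemma measurable_smallest_singular_value d (T : measurableType d) m
    (M : T -> 'M[R[i]]_m) (s : R) : (0 < m)%N -> 0 <= s -> mx_cmeasurable M ->
  measurable [set t | smallest_singular_value (M t) <= s].
Proof.
move=> m0 s0 mM.
rewrite (_ : [set t | _] = \bigcap_(l : nat) \bigcup_(r in
    [set r : rat | `|ratr r| < s + l.+1%:R^-1])
    [set t | gram_char (M t) (ratr r) < l.+1%:R^-1]); last first.
  apply/seteqP; split=> t /=.
    by move=> /(smallest_singular_value_leP _ m0 s0) h l _;
      have [r [r1 r2]] := h l; exists r.
  move=> h; apply/(smallest_singular_value_leP _ m0 s0) => l.
  by have [r r1 r2] := h l Logic.I; exists r.
apply: bigcapT_measurable => l; rewrite bigcup_mkcond.
apply: bigcupT_measurable_rat => r; case: ifPn => _; last exact: measurable0.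
have mG : mx_cmeasurable (fun t => ((ratr r) ^+ 2)%:C%:M - (M t)^t* *m M t).
  have mMM : mx_cmeasurable (fun t => (M t)^t* *m M t).
    apply: mx_cmeasurable_mul => // i j.
    rewrite (_ : (fun t => _) = fun t => (M t j i)^*); first exact: cmeasurable_conj.
    by apply/funext => t; rewrite !mxE.
  move=> i j; rewrite (_ : (fun t => _) = fun t =>
      (((ratr r) ^+ 2)%:C%:M : 'M[R[i]]_m) i j + - ((M t)^t* *m M t) i j).
    by apply: cmeasurableD; [exact: cmeasurable_cst|exact: cmeasurableN].
  by apply/funext => t; rewrite [LHS]mxE [X in _ + X]mxE.
rewrite (_ : [set t | _] = (fun t => gram_char (M t) (ratr r)) @^-1` `]-oo, l.+1%:R^-1[).
  rewrite -[X in measurable X]setTI.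
  by apply: measurable_normsq => //; exact: cmeasurable_det.
by apply/seteqP; split=> t /=; rewrite in_itv.
Qed.

End smallest_singular_value_measurable.

(** * A uniform union bound *)

Section finite_union.
Context d (T : measurableType d) (R : realType).

Lemma measure_bigsetU_le (mu : {measure set T -> \bar R}) (I : Type) (r : seq I)
    (F : I -> set T) (c : R) :
  (forall i, measurable (F i)) -> (forall i, (mu (F i) <= c%:E)%E) ->
  (mu (\big[setU/set0]_(i <- r) F i) <= (c *+ size r)%:E)%E.
Proof.
move=> mF Fc; elim: r => [|i r IHr]; first by rewrite big_nil measure0 mulr0n.
rewrite big_cons /= mulrS EFinD; apply: le_trans (measureU2 _ (mF i) _) _; first exact: bigsetU_measurable.
by apply: leeD; [exact: Fc|exact: IHr].
Qed.

End finite_union.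

(** * Volume of the small singular value event *)

Section small_singular_value_event.
Context (R : realType) (m : nat).
Implicit Types (t : (m * m).-tuple R) (G W : 'M[R[i]]_m).

Local Notation n := (m.+1%:R : R).
Local Notation vol := (tuple_lebesgue R (m * m)).
Local Notation inner := (@birkhoff_inner R m).

(* J stands for the all-ones matrix *)
Definition addJ : 'M[R[i]]_m := 1%:M + const_mx 1.

Definition subJ : 'M[R[i]]_m := 1%:M - const_mx (n^-1)%:C.

Lemma subJ_addJ : subJ *m addJ = 1%:M.
Proof.
have n0 : n != 0 by rewrite pnatr_eq0.
rewrite /subJ /addJ mulmxDr mulmx1 mulmxBl mul1mx.
have -> : (const_mx (n^-1)%:C : 'M[R[i]]_m) *m (const_mx 1 : 'M[R[i]]_m) =
    const_mx (m%:R * (n^-1)%:C).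
  apply/matrixP => i j; rewrite !mxE; under eq_bigr do rewrite !mxE mulr1.
  by rewrite sumr_const card_ord mulr_natl.
have e : 1 - m%:R * (n^-1)%:C = (n^-1)%:C :> R[i].
  apply/eqP; rewrite subr_eq -[X in X + _]mul1r -mulrDl nat1r.
  by rewrite -(rmorph_nat (real_complex R)) -rmorphM/= divff.
by apply/matrixP => i j; rewrite !mxE e subrK.
Qed.

(** The unit row sum replaces the subtracted entry [x_i1] by 1 minus the sum of the free entries of
    row [i]. *)
Lemma reduced_mxE (X : 'M[R]_m.+1) : doubly_stochastic X ->
  map_mx (real_complex R) (reduced_mx X) =
  map_mx (real_complex R) (free_mx (free_coords X)) *m addJ - const_mx 1.
Proof.
move=> [_ rX _]; rewrite /addJ mulmxDr mulmx1; apply/matrixP => i j.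
rewrite !mxE tnth_mktuple mxvecE !mxE.
under eq_bigr do rewrite [const_mx _ _ _]mxE mulr1 mxE free_mx_coords.
rewrite -rmorph_sum -rmorphD -[X in _ = _ - X](rmorph1 (real_complex R)) -rmorphB.
congr (real_complex _ _).
by rewrite -(rX (lift ord0 i)) big_ord_recl; lra.
Qed.

Definition shifted_free_mx G t : 'M[R[i]]_m := map_mx (real_complex R) (free_mx t) + G.

Lemma shifted_free_mx_shift G t s i j :
  shifted_free_mx G (shift_coord (mxvec_index i j) s t) =
  shifted_free_mx G t + s%:C *: delta_mx i j.
Proof.
rewrite /shifted_free_mx free_mx_shift addrAC; congr (_ + _).
apply/matrixP => a b; rewrite !mxE rmorphD rmorphM; congr (_ + _ * _).
by rewrite rmorph_nat.
Qed.

Lemma mx_cmeasurable_shifted_free_mx G : mx_cmeasurable (shifted_free_mx G).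
Proof.
move=> i j; rewrite (_ : (fun t => _) = fun t => (tnth t (mxvec_index i j))%:C + G i j).
  apply: cmeasurableD; last exact: cmeasurable_cst.
  by apply: cmeasurable_real; exact: measurable_tnth.
by apply/funext => t; rewrite !mxE.
Qed.

Lemma leading_mx_shift W (k : 'I_m) s :
  leading_mx k.+1 (W + s *: delta_mx k k) = leading_mx k.+1 W + s *: delta_mx k k.
Proof.
apply/matrixP => i j; rewrite !mxE; case: ifPn => // ij.
suff -> : (i == k) && (j == k) = false by rewrite mulr0 addr0.
by apply: contraNF ij => /andP[/eqP -> /eqP ->]; rewrite ltnSn.
Qed.

Lemma mx_cmeasurable_leading_mx d (T : measurableType d) k (W : T -> 'M[R[i]]_m) :
  mx_cmeasurable W -> mx_cmeasurable (fun w => leading_mx k (W w)).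
Proof.
move=> mW i j; rewrite (_ : (fun w => _) = fun w =>
    if (i < k)%N && (j < k)%N then W w i j else (i == j)%:R).
  by case: (_ && _); [exact: mW|exact: cmeasurable_cst].
by apply/funext => w; rewrite mxE.
Qed.

Lemma small_singular_value_slab W (s : R) : (0 < m)%N -> 0 < s -> \det W != 0 ->
  smallest_singular_value (W *m addJ) <= s ->
  exists ij : 'I_m * 'I_m, slab (m%:R * (4 * s * m%:R)) ij.1 ij.2 W.
Proof.
(* Doubling [s] makes the bound strict, so that some singular value lies below it. *)
move=> m0 s0 dW Ws; have s2 : s < 2 * s by lra.
have [x x0] := smallest_singular_value_lt m0 (le_lt_trans Ws s2).
rewrite -mulmxA; set z := addJ *m x => xz.
have xE : x = subJ *m z by rewrite mulmxA subJ_addJ mul1mx.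
clearbody z.
have [k kmax] := exists_max_norm z m0.
(* Here [x = z - J z / n], and each entry of [J z / n] is at most [m / n <= 1] times the largest
   entry of [z]. *)
have x_le i : `|x i 0| <= 2 * `|z k 0|.
  rewrite xE mulmxBl mul1mx !mxE (le_trans (ler_normB _ _))//.
  rewrite [2]mulr2n mulrDl mul1r lerD// ?kmax//.
  apply: le_trans (ler_norm_sum _ _ _) _.
  apply: (@le_trans _ _ (\sum_(i < m) (n^-1)%:C * `|z k 0|)).
    apply: ler_sum => l _; rewrite mxE normrM ler_pM//.
    by rewrite ger0_norm// (lecR 0) invr_ge0.
  rewrite sumr_const card_ord -mulrnAl ler_piMl// -rmorphMn (lecR _ 1).
  by rewrite -mulr_natr mulrC ler_pdivrMr ?mul1r ?ler_nat// ltr0n.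
have zk0 : z k 0 != 0.
  apply: contra x0 => /eqP z0; apply/eqP/colP => i; apply/eqP.
  by rewrite mxE -normr_le0; have := x_le i; rewrite z0 normr0 mulr0.
(* The squared norm of [W z] is at most [(2 s)^2 * 4 m * |z_k|^2]; the resulting factor [sqrt m] is
   rounded up to [m]. *)
have W_le j : `|(W *m z) j 0| <= (4 * s * m%:R)%:C * `|z k 0|.
  have r0 : 0 <= (4 * s * m%:R)%:C by rewrite (lecR 0) !mulr_ge0// ltW.
  rewrite -(@ler_pXn2r _ 2) ?nnegrE ?mulr_ge0//.
  apply: le_trans (le_trans xz _).
    by rewrite (bigD1 j)//= lerDl sumr_ge0// => l _; rewrite exprn_ge0.
  apply: (@le_trans _ _ (((2 * s) ^+ 2)%:C * \sum_(i < m) (2 * `|z k 0|) ^+ 2)).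
    apply: ler_wpM2l; first by rewrite (lecR 0) sqr_ge0.
    by apply: ler_sum => l _; rewrite lerXn2r ?nnegrE ?mulr_ge0.
  have -> : ((2 * s) ^+ 2)%:C * \sum_(i < m) (2 * `|z k 0|) ^+ 2 =
      ((2 * s) ^+ 2 * (m%:R * 4))%:C * `|z k 0| ^+ 2.
    have nC p : (p%:R : R)%:C = p%:R :> R[i] by exact: rmorph_nat.
    have MC (u v : R) : (u * v)%:C = u%:C * v%:C by exact: rmorphM.
    rewrite sumr_const card_ord -[_ *+ m]mulr_natl (MC (_ ^+ 2)) MC !nC.
    by ring.
  rewrite [X in _ <= X]exprMn -[X in _ <= X * _]rmorphXn ler_wpM2r ?exprn_ge0// lecR.
  have -> : (4 * s * m%:R) ^+ 2 = (2 * s) ^+ 2 * (m%:R * 4) * m%:R by ring.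
  have m1 : 1 <= m%:R :> R by rewrite ler1n.
  by rewrite ler_peMr// mulr_ge0 ?sqr_ge0// mulr_ge0.
have eta0 : 0 <= 4 * s * m%:R by rewrite !mulr_ge0// ltW.
by have [j jk] := slab_of_small_image eta0 dW zk0 W_le; exists (j, k).
Qed.

Lemma Bernoulli_ineq (x : R) k : 0 <= x <= 1 -> 1 - x *+ k <= (1 - x) ^+ k.
Proof.
move=> /andP[x0 x1]; elim: k => [|k IHk]; first by rewrite mulr0n subr0.
rewrite exprS; apply: le_trans (ler_wpM2l _ IHk); last by rewrite subr_ge0.
have : 0 <= x * (x *+ k) by rewrite mulr_ge0// mulrn_wge0.
by rewrite mulrSr; lra.
Qed.

Lemma tuple_lebesgue_birkhoff_boundary (e v : R) : 0 <= e -> n * e < 1 ->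
  vol (inner 0) = v%:E ->
  (vol (inner 0 `\` inner e) <=
   ((n * e) *+ (m * m) * v)%:E)%E.
Proof.
move=> e0 e1 volK.
have mI := @measurable_birkhoff_inner R m.
have Koo : (vol (inner 0) < +oo)%E by rewrite volK ltry.
have -> : (vol (inner 0 `\` inner e) =
    vol (inner 0) -
    vol (inner 0 `&` inner e))%E.
  exact: measureD.
rewrite (_ : inner 0 `&` inner e = inner e); last first.
  by rewrite setIidr// => t te i j; exact: le_trans (te i j).
rewrite -(@tuple_lebesgue_birkhoff_inner _ _ e) ?subr_gt0// volK -EFinM -EFinB lee_fin.
have v0 : 0 <= v by rewrite -lee_fin -volK.
have /Bernoulli_ineq-/(_ (m * m)%N) : 0 <= n * e <= 1 by rewrite mulr_ge0//= ltW.
by move=> /(ler_wpM2r v0); rewrite mulrBl mul1r; lra.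
Qed.

Lemma tuple_lebesgue_small_singular_value G (s q v : R) :
  (0 < m)%N -> 0 < q <= 1 -> 0 < s -> 80 * n ^+ 7 * s < q ^+ 2 ->
  vol (inner 0) = v%:E ->
  (vol ([set t | (smallest_singular_value
       (shifted_free_mx G t *m addJ) <= s)%R] `&` inner 0) <= (q * v)%:E)%E.
Proof.
move=> m0 /andP[q0 q1] s0 sq volK.
have v0 : 0 <= v by rewrite -lee_fin -volK.
have n0 : 0 < n by rewrite ltr0n.
have n1 : 1 <= n by rewrite ler1n.
have mn : m%:R <= n by rewrite ler_nat.
(* There are [m^2 + m <= 2 n^2] slabs, each of relative volume at most [1 / N]; [N > 4 n^2 / q]
   keeps their total below [q / 2]. *)
pose N := (Num.truncn (4 * n ^+ 2 / q)).+1.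
have N0 : 0 < N%:R :> R by rewrite ltr0n.
have qN4 : 4 * n ^+ 2 < q * N%:R by rewrite [q * _]mulrC -ltr_pdivrMr// truncnS_gt.
have qN5 : q * N%:R <= 5 * n ^+ 2.
  have : N%:R <= 4 * n ^+ 2 / q + 1 :> R.
    by rewrite /N -[X in X <= _]natr1 lerD2r truncn_le divr_ge0 ?mulr_ge0 ?exprn_ge0// ltW.
  move=> /(ler_wpM2l (ltW q0)); rewrite mulrDr mulrCA mulfV ?gt_eqF// !mulr1.
  by move=> /le_trans; apply; have := exprn_ege1 2 n1; lra.
(* Chosen so that the boundary layer, of relative volume at most [m^2 n e], takes the other
   [q / 2]. *)
pose e := q / (2 * n ^+ 3).
have e0 : 0 < e by rewrite divr_gt0 ?mulr_gt0 ?exprn_gt0.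
have ne : n * e = q / (2 * n ^+ 2) by rewrite /e; field; rewrite gt_eqF.
pose tau := e / N%:R.
have tauN : tau *+ N <= e by rewrite -mulr_natr divfK ?gt_eqF.
pose kappa := m%:R * (4 * s * m%:R).
have kappa0 : 0 <= kappa by rewrite !mulr_ge0// ltW.
(* With denominators cleared and after multiplying by [q], the claim is [16 s n^3 m^2 (q N) < q^2];
   [m <= n] and [q N <= 5 n^2] bound the left side by [80 n^7 s]. *)
have kappatau : kappa *+ 2 < tau.
  rewrite /tau ltr_pdivlMr// /e ltr_pdivlMr ?mulr_gt0 ?exprn_gt0//.
  rewrite -(ltr_pM2l q0) -expr2; apply: le_lt_trans sq.
  have -> : q * (kappa *+ 2 * N%:R * (2 * n ^+ 3)) =
    (16 * s * n ^+ 3) * ((m%:R ^+ 2) * (q * N%:R)) by rewrite /kappa; ring.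
  have -> : 80 * n ^+ 7 * s = (16 * s * n ^+ 3) * (n ^+ 2 * (5 * n ^+ 2)) by ring.
  apply: ler_wpM2l; first by rewrite !mulr_ge0 ?exprn_ge0// ltW.
  by apply: ler_pM; rewrite ?mulr_ge0 ?sqr_ge0 ?(ltW q0)// lerXn2r ?nnegrE.
pose W := shifted_free_mx G.
have mW : mx_cmeasurable W by exact: mx_cmeasurable_shifted_free_mx.
pose S1 (ij : 'I_m * 'I_m) := [set t | slab kappa ij.1 ij.2 (W t)] `&` inner e.
pose S2 (k : 'I_m) :=
  [set t | slab kappa k k (leading_mx k.+1 (W t))] `&` inner e.
have mI := @measurable_birkhoff_inner R m.
have mS1 ij : measurable (S1 ij) by apply: measurableI => //; exact: measurable_slab.
have mS2 k : measurable (S2 k).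
  apply: measurableI => //; apply: measurable_slab.
  exact: mx_cmeasurable_leading_mx.
have leS1 ij : (vol (S1 ij) <= (N%:R^-1 * v)%:E)%E.
  rewrite EFinM lee_pdivlMl// -volK; apply: (tuple_lebesgue_slab (tau := tau) mW) => //.
  by move=> t r; exact: shifted_free_mx_shift.
have leS2 k : (vol (S2 k) <= (N%:R^-1 * v)%:E)%E.
  rewrite EFinM lee_pdivlMl// -volK.
  apply: (tuple_lebesgue_slab (tau := tau) (mx_cmeasurable_leading_mx k.+1 mW)) => //.
  by move=> t r; rewrite /W shifted_free_mx_shift leading_mx_shift.
have mU : measurable [set t | smallest_singular_value (W t *m addJ) <= s].
  apply: measurable_smallest_singular_value => //; first exact: ltW.
  apply: mx_cmeasurable_mul => // i j; exact: cmeasurable_cst.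
pose U1 := \big[setU/set0]_(ij <- enum {: 'I_m * 'I_m}) S1 ij.
pose U2 := \big[setU/set0]_(k <- enum 'I_m) S2 k.
have mU1 : measurable U1 by exact: bigsetU_measurable.
have mU2 : measurable U2 by exact: bigsetU_measurable.
have mK : measurable (inner 0 `\` inner e) by exact: measurableD.
have leU : (vol ([set t | (smallest_singular_value (W t *m addJ) <= s)%R] `&` inner 0) <=
    vol ((inner 0 `\` inner e) `|` (U1 `|` U2)))%E.
  apply: le_measure; rewrite ?inE//.
  - exact: measurableI.
  - by apply: measurableU => //; exact: measurableU.
  (* Three cases: the boundary layer, a vanishing determinant (a leading block is in a slab), and a
     nonzero one ([W] itself is). *)
  move=> t [/= Ut tK]; have [te|te] := pselect (inner e t); last by left.
  right; have [W0|W0] := eqVneq (\det (W t)) 0.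
    right; rewrite /U2 -bigcup_seq; apply: contrapT => nS.
    have /negP[] : \det (W t) != 0; last exact/eqP.
    apply: (@det_neq0_of_slabs _ _ _ kappa) => l Sl; apply: nS; exists l => //.
    by rewrite /= mem_enum.
  left; have [p Sp] := small_singular_value_slab m0 s0 W0 Ut.
  by rewrite /U1 -bigcup_seq; exists p => //; rewrite /= mem_enum.
have leU' : (vol ((inner 0 `\` inner e) `|` (U1 `|` U2)) <=
    vol (inner 0 `\` inner e) + vol (U1 `|` U2))%E.
  by apply: measureU2 => //; exact: measurableU.
apply: le_trans (le_trans leU leU') _.
have ne1 : n * e < 1.
  rewrite ne ltr_pdivrMr ?mulr_gt0 ?exprn_gt0// mul1r (le_lt_trans q1)//.
  by have := exprn_ege1 2 n1; lra.
have le0 := tuple_lebesgue_birkhoff_boundary (ltW e0) ne1 volK.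
have le1 := measure_bigsetU_le (enum {: 'I_m * 'I_m}) mS1 leS1.
have le2 := measure_bigsetU_le (enum 'I_m) mS2 leS2.
have le12 := le_trans (measureU2 vol mU1 mU2) (leeD le1 le2).
apply: le_trans (leeD le0 le12) _.
rewrite -!cardE card_prod card_ord -!EFinD lee_fin -mulrnDr.
have -> : q * v = q / 2 * v + q / 2 * v by field.
apply: lerD.
  apply: ler_wpM2r => //; rewrite ne -[_ *+ (m * m)]mulr_natr natrM mulrAC.
  rewrite ler_pdivrMr ?mulr_gt0 ?exprn_gt0//.
  have -> : q / 2 * (2 * n ^+ 2) = q * n ^+ 2 by field.
  by rewrite ler_pM2l// expr2 ler_pM.
rewrite -[_ *+ (m * m + m)]mulr_natr mulrAC; apply: ler_wpM2r => //.
rewrite ler_pdivrMl// natrD natrM.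
have m2 : m%:R * m%:R <= n ^+ 2 by rewrite expr2 ler_pM.
have m3 : m%:R <= n ^+ 2 by rewrite (le_trans mn)// expr2 ler_peMr// ltW.
by move: qN4 m2 m3; rewrite mulrC; lra.
Qed.

End small_singular_value_event.

(** * Passing from the uniform law to volumes *)

Section uniform_measure.
Context (R : realType) (m : nat).

(** Taking [U] to be the whole space gives [1 = vol / vol]. In the extended reals this quotient is 0
    when [vol] is 0 or infinite, which excludes both. *)
Lemma uniform_doubly_stochastic_volume d (T : measurableType d)
    (P : probability T R) (X : T -> 'M[R]_m.+1) :
  uniform_doubly_stochastic P X ->
  exists2 v : R, 0 < v & tuple_lebesgue R (m * m) (@birkhoff_inner R m 0) = v%:E.
Proof.
move=> [_ _ /(_ setT measurableT)]; rewrite setTI birkhoff_bodyE.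
have -> : [set w | [set: (m * m).-tuple R] (free_coords (X w))] = setT by apply/seteqP.
rewrite probability_setT; set vol := tuple_lebesgue R _ _.
have : (0 <= vol)%E by exact: measure_ge0.
case: vol => [v| |] //; last by rewrite invey mule0 => _ /eqP; rewrite onee_eq0.
rewrite lee_fin le_eqVlt => /orP[/eqP <-|v0 _]; last by exists v.
by rewrite mul0e => /eqP; rewrite onee_eq0.
Qed.

(** The shift [G = (F - J) (1 - J / n)] solves [G (1 + J) = F - J], absorbing both [F] and the
    constant term of the reduced matrix. *)
Lemma reduced_mxD (X : 'M[R]_m.+1) (F : 'M[R[i]]_m) : doubly_stochastic X ->
  map_mx (real_complex R) (reduced_mx X) + F =
  shifted_free_mx ((F - const_mx 1) *m @subJ R m) (free_coords X) *m @addJ R m.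
Proof.
move=> dX; rewrite reduced_mxE// mulmxDl -mulmxA subJ_addJ mulmx1.
by rewrite -addrA [- _ + F]addrC.
Qed.

End uniform_measure.

Theorem theorem3p1 (R : realType) (gamma : R) (gamma_gt0 : 0 < gamma)
    (B : R) (B_gt0 : 0 < B) :
  exists A : R, 0 < A /\
  exists n0 : nat, forall m : nat, (n0 <= m.+1)%N ->
  forall F : 'M[R[i]]_m,
    (forall i j, `|F i j| <= (m.+1%:R `^ gamma)%:C) ->
  forall (d : measure_display) (T : measurableType d) (P : probability T R)
    (X : T -> 'M[R]_m.+1),
    uniform_doubly_stochastic P X ->
  (P [set w | (smallest_singular_value
                 (map_mx (real_complex R) (reduced_mx (X w)) + F)
               <= m.+1%:R `^ (- A))%R]
   <= (m.+1%:R `^ (- B))%:E)%E.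
Proof.
(* With [q = n^(-B)] and [s = n^(-A)] this exponent gives [q^2 = n^14 s], so [80 n^7 s < q^2]
   reduces to [80 < n^7]. *)
exists (2 * B + 14); split; first by rewrite addr_gt0// mulr_gt0.
(* [n >= 2] yields [m > 0] as well as [n^7 >= 128 > 80]. *)
exists 2%N => m m2 F _ d T P X uX.
have [v v0 volK] := uniform_doubly_stochastic_volume uX; case: uX => dX _ unifX.
set n : R := m.+1%:R; set q := n `^ (- B); set s := n `^ (- (2 * B + 14)).
have n2 : 2 <= n by rewrite ler_nat.
have n0 : 0 < n by rewrite (lt_le_trans _ n2).
have q01 : 0 < q <= 1.
  rewrite powR_gt0//= -(powRr0 n) ler_powR ?oppr_le0 ?(ltW B_gt0)//.
  by rewrite (le_trans _ n2)// ler1n.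
have s0 : 0 < s by rewrite powR_gt0.
have sq : 80 * n ^+ 7 * s < q ^+ 2.
  have -> : q ^+ 2 = n ^+ 7 * n ^+ 7 * s.
    rewrite -exprD -!powR_mulrn ?ltW ?powR_gt0// /q /s -powRrM -powRD; last first.
      by rewrite (gt_eqF n0) implybT.
    by congr (_ `^ _); lra.
  rewrite ltr_pM2r// ltr_pM2r ?exprn_gt0//.
  apply: (@lt_le_trans _ _ (2 ^+ 7)); last by rewrite lerXn2r ?nnegrE// ltW.
  by rewrite -natrX ltr_nat.
pose G := (F - const_mx 1) *m @subJ R m.
pose U := [set t | smallest_singular_value (shifted_free_mx G t *m @addJ R m) <= s].
have mU : measurable U.
  apply: measurable_smallest_singular_value; [exact: m2|exact: ltW|].
  apply: mx_cmeasurable_mul => [|i j]; last exact: cmeasurable_cst.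
  exact: mx_cmeasurable_shifted_free_mx.
rewrite (_ : [set w | _] = [set w | U (free_coords (X w))]); last first.
  by apply/seteqP; split=> w /=; rewrite /U/= reduced_mxD.
rewrite unifX// birkhoff_bodyE volK inver gt_eqF// lee_pdivrMr// -EFinM.
exact: tuple_lebesgue_small_singular_value.
Qed.
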